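(* For all integers $n$ and $m$ with $m>n\geq 2$, $$\frac{3m+\sqrt{m^2+8n^2}}{2}-8<R(K_{1,m}, F_{n})< \frac{3m+\sqrt{m^2+8n^2}}{2}+1.$$ In particular, for all integers $n\ge 2$, $(3+\sqrt{3})n-8< R(K_{1,2n}, F_n)< (3+\sqrt{3})n+1$.
   Context: For a positive integer $n$, the $n$-fan $F_n$ is the graph on $2n+1$ vertices consisting of $n$ triangles that all share one common vertex and are otherwise vertex-disjoint (i.e. a vertex joined to all vertices of a matching with $n$ edges). $K_{1,m}$ is the star with $m$ edges. For graphs $H_1,H_2$, the Ramsey number $R(H_1,H_2)$ is the smallest $N$ such that every coloring of the edges of $K_N$ with colors $1$ and $2$ contains a copy of $H_1$ all of whose edges have color $1$ or a copy of $H_2$ all of whose edges have color $2$ (copies are not necessarily induced). *)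

(* Defs.v *)
From mathcomp Require Import all_boot.

Set Implicit Arguments.
Unset Strict Implicit.
Unset Printing Implicit Defensive.

Record sgraph := SGraph {
  vertex :> finType;
  edge : rel vertex;
  edge_sym : symmetric edge;
  edge_irr : irreflexive edge
}.

(* The star K_{1,m}: None is the centre, Some i the i-th leaf. *)
Definition star_edge (m : nat) : rel (option 'I_m) :=
  fun x y => match x, y with
             | None, Some _ | Some _, None => true
             | _, _ => false
             end.

Lemma star_sym m : symmetric (@star_edge m).
Proof. by move=> [x|] [y|]. Qed.

Lemma star_irr m : irreflexive (@star_edge m).
Proof. by move=> [x|]. Qed.

Definition star (m : nat) : sgraph := SGraph (@star_sym m) (@star_irr m).

(* The fan F_n: None is the common vertex, and Some (i, false), Some (i, true)
   are the two other vertices of the i-th triangle. *)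
Definition fan_edge (n : nat) : rel (option ('I_n * bool)) :=
  fun x y => match x, y with
             | None, Some _ | Some _, None => true
             | Some (i, a), Some (j, b) => (i == j) && (a != b)
             | None, None => false
             end.

Lemma fan_sym n : symmetric (@fan_edge n).
Proof.
by move=> [[i a]|] [[j b]|] //=; rewrite (eq_sym i) (eq_sym a).
Qed.

Lemma fan_irr n : irreflexive (@fan_edge n).
Proof. by move=> [[i a]|] //=; rewrite !eqxx. Qed.

Definition fan (n : nat) : sgraph := SGraph (@fan_sym n) (@fan_irr n).

(* A colouring of the edges of K_N assigns a colour to every 2-subset of 'I_N.
   It is given here on all subsets of 'I_N, but only its values on the
   2-subsets are ever used. Colour 1 is false and colour 2 is true. *)
Definition coloring (N : nat) := {ffun {set 'I_N} -> bool}.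

Definition mono_copy (H : sgraph) (N : nat) (c : coloring N) (a : bool) : bool :=
  [exists f : {ffun H -> 'I_N},
     injectiveb f &&
     [forall u : H, forall v : H, edge u v ==> (c [set f u; f v] == a)]].

Definition arrows (H1 H2 : sgraph) (N : nat) : bool :=
  [forall c : coloring N, mono_copy H1 c false || mono_copy H2 c true].

Lemma ramsey_clique (k l : nat) : exists N : nat,
  forall (T : finType) (c : {set T} -> bool) (A : {set T}), N <= #|A| ->
  exists (a : bool) (S : {set T}), #|S| = (if a then l else k) /\
    {in S &, forall x y, x != y -> c [set x; y] = a}.
Proof.
move: {2}(k + l) (leqnn (k + l)) => s; elim: s k l => [|s IHs] k l.
  rewrite leqn0 addn_eq0 => /andP[/eqP-> _]; exists 0 => T c A _.
  by exists false, set0; split=> [|x y]; rewrite ?cards0 ?inE.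
case: k => [|k] le_kl_s.
  exists 0 => T c A _.
  by exists false, set0; split=> [|x y]; rewrite ?cards0 ?inE.
case: l le_kl_s => [|l] le_kl_s.
  exists 0 => T c A _.
  by exists true, set0; split=> [|x y]; rewrite ?cards0 ?inE.
have [|N1 HN1] := IHs k l.+1; first by rewrite -ltnS.
have [|N2 HN2] := IHs k.+1 l; first by rewrite -ltnS -addnS.
exists (N1 + N2).+1 => T c A leNA.
have /card_gt0P[x xA] : 0 < #|A| by apply: leq_ltn_trans leNA.
pose B (a : bool) := [set y in A :\ x | c [set x; y] == a].
have cardB : #|B false| + #|B true| = #|A :\ x|.
  rewrite -(cardsID (B true) (A :\ x)) addnC; congr (_ + _); apply: eq_card => y.
    by rewrite !inE; case: (y == x); case: (y \in A).
  by rewrite !inE; case: (y == x); case: (y \in A); case: (c _).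
have extend (a : bool) (S : {set T}) : S \subset B a ->
    {in S &, forall y z, y != z -> c [set y; z] = a} ->
    #|x |: S| = #|S|.+1 /\
    {in x |: S &, forall y z, y != z -> c [set y; z] = a}.
  move=> /subsetP sSB hS; split.
    by rewrite cardsU1; case: (boolP (x \in S)) => // /sSB; rewrite !inE eqxx.
  have hx y : y \in S -> c [set x; y] = a.
    by move=> /sSB; rewrite !inE => /andP[_ /eqP].
  move=> y z; rewrite !inE => /orP[/eqP->|yS] /orP[/eqP->|zS]; rewrite ?eqxx //.
  - by move=> _; apply: hx.
  - by move=> _; rewrite setUC; apply: hx.
  - exact: hS.
pose cB (a : bool) : {set {y | y \in B a}} -> bool := fun X => c [set val y | y in X].
have lift (a b : bool) (p : nat) (X : {set {y | y \in B a}}) : #|X| = p ->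
    {in X &, forall y z, y != z -> cB a [set y; z] = b} ->
    exists S : {set T}, [/\ #|S| = p, S \subset B a &
      {in S &, forall y z, y != z -> c [set y; z] = b}].
  move=> cX hX; exists [set val y | y in X]; split.
  - by rewrite card_imset //; apply: val_inj.
  - by apply/subsetP => _ /imsetP[y _ ->]; apply: valP.
  - move=> _ _ /imsetP[y yX ->] /imsetP[z zX ->] neq.
    have nyz : y != z by apply: contraNneq neq => ->.
    by rewrite -(hX y z yX zX nyz) /cB imsetU1 imset_set1.
have cardT a : #|[set: {y | y \in B a}]| = #|B a| by rewrite cardsT card_sig.
have [le1|lt1] := leqP N1 #|B false|.
  rewrite -cardT in le1.
  have [[] [X [cX hX]]] := HN1 _ (cB false) _ le1; have [S [cS sS hS]] := lift _ _ _ _ cX hX.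
    by exists true, S.
  by have [cU hU] := extend _ _ sS hS; exists false, (x |: S); rewrite cU cS.
have le2 : N2 <= #|B true|.
  rewrite (cardsD1 x A) xA -cardB add1n ltnS in leNA.
  rewrite -(leq_add2l N1); apply: leq_trans leNA _.
  by rewrite leq_add2r ltnW.
rewrite -cardT in le2.
have [[] [X [cX hX]]] := HN2 _ (cB true) _ le2; have [S [cS sS hS]] := lift _ _ _ _ cX hX.
  by have [cU hU] := extend _ _ sS hS; exists true, (x |: S); rewrite cU cS.
by exists false, S.
Qed.

Lemma arrows_exists (H1 H2 : sgraph) : exists N : nat, arrows H1 H2 N.
Proof.
have [N HN] := ramsey_clique #|H1| #|H2|; exists N; apply/forallP => c.
have leN : N <= #|[set: 'I_N]| by rewrite cardsT card_ord.
have copy (H : sgraph) (a : bool) (S : {set 'I_N}) : #|S| = #|H| ->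
    {in S &, forall x y, x != y -> c [set x; y] = a} -> mono_copy H c a.
  move=> cS hS; pose g (u : H) := enum_val (cast_ord (esym cS) (enum_rank u)).
  have g_inj : injective g.
    by move=> u v /enum_val_inj/cast_ord_inj/enum_rank_inj.
  apply/existsP; exists (finfun g); apply/andP; split.
    by apply/injectiveP => u v; rewrite !ffunE => /g_inj.
  apply/forallP => u; apply/forallP => v; apply/implyP => uv; rewrite !ffunE.
  rewrite hS ?enum_valP //.
  by apply: contraTneq uv => /g_inj->; rewrite edge_irr.
have [[] [S [cS hS]]] := HN _ c _ leN; apply/orP; [right|left]; exact: copy cS hS.
Qed.

Definition ramsey (H1 H2 : sgraph) : nat := ex_minn (arrows_exists H1 H2).

(* Main.v *)
(* Let G be the graph of colour 2, with N = 2m + t vertices: its degrees are at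
   least d = m + t and every neighbourhood has matching number at most p = n - 1.
   Upper bound, assuming t d >= 2 n^2. By a weak Tutte-Berge formula N(v) contains
   disjoint sets S_v, I_v, with I_v independent and |I_v| >= |N(v)| + |S_v| - 2p,
   such that every other vertex of N(v) has at most one neighbour in I_v. Choose
   x in I_v with no neighbour in N(v) outside S_v. Then N(v) \ S_v and N(x) are
   disjoint, so I_v and I_x are disjoint independent sets; trim both to a common
   size k. The edges leaving them number at least 2kd. On the other hand a vertex
   of N(v) \ S_v or N(x) \ S_x sends at most k + 1 edges into them, and any of
   the at most |S_v| + |S_x| - t other vertices sends at most k + p, because the
   bipartite graph between the two sets is nearly complete. This gives
   t d < 2 n^2.
   Lower bound: in the extremal structure each half of G is an independent set of
   size i together with s further vertices, joined to it by a bipartite graph of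
   degrees y and about n, where s + y is about n and t = 2y. *)
Require Import Defs.
From mathcomp Require Import all_boot all_order all_algebra.
From mathcomp Require Import zify ring lra.
Import Order.TTheory GRing.Theory Num.Theory.

Set Implicit Arguments.
Unset Strict Implicit.
Unset Printing Implicit Defensive.

(** * Matchings as vertex sets, exchange, and a weak Tutte-Berge formula *)

Section Matchings.
Variables (T : finType) (e : rel T).
Hypotheses (e_sym : symmetric e) (e_irr : irreflexive e).

(** A matching is represented by the set of vertices it covers, with [f] sending each vertex to its
    partner; the number of edges is half of [#|A|]. *)
Definition matchable (A : {set T}) : bool :=
  [exists f : {ffun T -> T},
    [forall x in A, [&& f x \in A, f (f x) == x & e x (f x)]]].

Lemma matchable0 : matchable set0.
Proof.
by apply/existsP; exists [ffun x => x]; apply/forall_inP => x; rewrite inE.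
Qed.

Lemma matchable_add (A : {set T}) (x y : T) :
  e x y -> x \notin A -> y \notin A -> matchable A ->
  matchable (x |: (y |: A)) /\ #|x |: (y |: A)| = #|A|.+2.
Proof.
move=> exy xA yA /existsP[f /forall_inP Hf].
have nxy : x != y by apply: contraTneq exy => ->; rewrite e_irr.
split; last by rewrite !cardsU1 !inE negb_or nxy xA yA.
apply/existsP; exists [ffun z => if z == x then y else if z == y then x else f z].
apply/forall_inP => z; rewrite !inE => Hz; rewrite !ffunE.
have [->|nzx] := eqVneq z x; first by rewrite (eq_sym y) (negPf nxy) !eqxx orbT exy.
have [->|nzy] := eqVneq z y; first by rewrite !eqxx e_sym exy.
rewrite (negPf nzx) (negPf nzy) /= in Hz.
have /and3P[fzA ffz ezf] := Hf z Hz.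
have nfx : f z != x by apply: contraNneq xA => <-.
have nfy : f z != y by apply: contraNneq yA => <-.
by rewrite (negPf nfx) (negPf nfy) fzA ffz ezf.
Qed.

Lemma matchable_remove (A : {set T}) (z : T) :
  matchable A -> z \in A ->
  exists w, [/\ e z w, w \in A, matchable (A :\ z :\ w) & #|A| = #|A :\ z :\ w|.+2].
Proof.
move=> /existsP[f /forall_inP Hf] zA; have /and3P[fzA /eqP ffz ezf] := Hf z zA.
have nzf : f z != z by apply: contraTneq ezf => ->; rewrite e_irr.
exists (f z); split=> //; last first.
  by rewrite (cardsD1 z A) (cardsD1 (f z) (A :\ z)) !inE zA fzA nzf.
apply/existsP; exists f; apply/forall_inP => x; rewrite !inE => /and3P[nxf nxz xA].
have /and3P[fxA /eqP ffx exf] := Hf x xA.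
rewrite fxA ffx eqxx exf !andbT; apply/andP; split.
  by apply: contraNneq nxz => H; rewrite -ffx H ffz.
by apply: contraNneq nxf => <-; rewrite ffx.
Qed.

Lemma matchable_even (A : {set T}) : matchable A -> ~~ odd #|A|.
Proof.
have [k] := ubnP #|A|; elim: k A => // k IHk A ltAk mA.
have [->|[z zA]] := set_0Vmem A; first by rewrite cards0.
have [w [_ _ mB cA]] := matchable_remove mA zA.
by rewrite cA /= negbK IHk // -ltnS (leq_trans _ ltAk) // cA.
Qed.

(** Serves to build a fan: the pair at positions [i.*2] and [i.*2.+1] becomes the outer edge of the
    [i]-th triangle. *)
Lemma matchable_pairs (x0 : T) (A : {set T}) (n : nat) :
  matchable A -> n.*2 <= #|A| ->
  exists t : seq T, [/\ size t = n.*2, uniq t, {subset t <= A} &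
    forall i, i < n -> e (nth x0 t i.*2) (nth x0 t i.*2.+1)].
Proof.
elim: n A => [|n IHn] A mA leA; first by exists [::].
have /card_gt0P[z zA] : 0 < #|A| by apply: leq_trans leA.
have [w [ezw wA mB cA]] := matchable_remove mA zA.
have [|t [size_t uniq_t sub_t e_t]] := IHn _ mB.
  by move: leA; rewrite cA doubleS !ltnS.
have tz y : y \in t -> [/\ y != z, y != w & y \in A].
  by move/sub_t; rewrite !inE => /and3P[].
exists [:: z, w & t]; split=> /=.
- by rewrite size_t.
- rewrite inE uniq_t andbT; apply/andP; split; last first.
    by apply/negP => /tz[]; rewrite eqxx.
  rewrite negb_or; apply/andP; split; last by apply/negP => /tz[]; rewrite eqxx.
  by apply: contraTneq ezw => ->; rewrite e_irr.
- by move=> y; rewrite !inE => /or3P[/eqP->|/eqP->|/tz[]].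
- by case=> [|i] //= lt_i; apply: e_t.
Qed.

(* Induction on the size of the two matchings: deleting the edge of A at z and
   the incident edge of A' replaces the path-switching argument in the symmetric
   difference of two maximum matchings. *)
Lemma matchable_exchange (V A A' : {set T}) (u u' z : T) :
  matchable A -> matchable A' -> A \subset V -> A' \subset V -> #|A| = #|A'| ->
  u != u' -> u \notin A -> u' \notin A -> z \notin A' ->
  exists B : {set T}, [/\ matchable B, B \subset V &
    (#|B| = #|A| /\ z \notin B /\ ((u \notin B) || (u' \notin B)))
    \/ #|B| = #|A|.+2].
Proof.
have [k] := ubnP #|A|; elim: k V A A' z => // k IHk V A A' z ltAk.
move=> mA mA' sAV sA'V eqAA' nuu' uA u'A zA'.
case: (boolP (z \in A)) => zA; last by exists A; split=> //; left; rewrite uA.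
have [z1 [ezz1 z1A mA1 cA]] := matchable_remove mA zA.
have nzz1 : z != z1 by apply: contraTneq ezz1 => ->; rewrite e_irr.
case: (boolP (z1 \in A')) => z1A'; last first.
  have [mB cB] := matchable_add ezz1 zA' z1A' mA'.
  exists (z |: (z1 |: A')); split=> //; last by right; rewrite cB eqAA'.
  by rewrite !subUset !sub1set sA'V !(subsetP sAV).
have [z2 [ez12 z2A' mA'1 cA']] := matchable_remove mA' z1A'.
have nz12 : z1 != z2 by apply: contraTneq ez12 => ->; rewrite e_irr.
have nz2z : z2 != z by apply: contraNneq zA' => <-.
case: (boolP (z2 \in A)) => z2A; last first.
  have [||mB cB] := matchable_add ez12 _ _ mA1.
  - by rewrite !inE eqxx.
  - by rewrite !inE (negPf z2A) !andbF.
  exists (z1 |: (z2 |: (A :\ z :\ z1))); split=> //.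
    rewrite !subUset !sub1set (subsetP sAV) // (subsetP sA'V) //=.
    by apply/subsetP=> y; rewrite !inE => /and3P[_ _ /(subsetP sAV)].
  left; rewrite cB cA; split=> //; split.
    by rewrite !inE (negPf nzz1) eq_sym (negPf nz2z) eqxx andbF.
  have n1 y : y \notin A -> y != z1 by move=> yA; apply: contraNneq yA => ->.
  rewrite !inE (negPf (n1 _ uA)) (negPf (n1 _ u'A)) (negPf uA) (negPf u'A) !andbF !orbF /=.
  by case: eqVneq => //= <-; rewrite eq_sym.
(* Remaining case: [z z1] is an edge of A, [z1 z2] an edge of A', and A covers [z2]. After both
   edges are deleted, the induction runs with [z2] in the role of [z]. If B keeps the size, it
   misses [z2] and [z1 z2] is added back; if B is larger, [z z1] is. *)
pose W := V :\ z :\ z1.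
have [||||||||B [mB sBW HB]] := IHk W (A :\ z :\ z1) (A' :\ z1 :\ z2) z2 _ mA1 mA'1.
- by rewrite -ltnS (leq_trans _ ltAk) // cA.
- by rewrite !setSD.
- apply/subsetP=> y; rewrite !inE => /and3P[_ -> yA'].
  by rewrite (subsetP sA'V) // andbT; apply: contraNneq zA' => <-.
- by move: eqAA'; rewrite cA cA' => -[].
- by [].
- by rewrite !inE (negPf uA) !andbF.
- by rewrite !inE (negPf u'A) !andbF.
- by rewrite !inE eqxx.
have sBV : B \subset V by apply: subset_trans sBW (subset_trans (subD1set _ _) (subD1set _ _)).
have zB : z \notin B by apply: contraL sBW => zB; apply/subsetPn; exists z;
  rewrite // !inE eqxx andbF.
have z1B : z1 \notin B by apply: contraL sBW => z1B; apply/subsetPn; exists z1;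
  rewrite // !inE eqxx.
case: HB => [[cB [z2B uB]]|cB].
  have [mC cC] := matchable_add ez12 z1B z2B mB.
  exists (z1 |: (z2 |: B)); split=> //.
    by rewrite !subUset !sub1set sBV (subsetP sA'V) ?(subsetP sA'V).
  left; rewrite cC cB -cA; split=> //; split.
    by rewrite !inE (negPf nzz1) eq_sym (negPf nz2z).
  have n1 y : y \notin A -> (y == z1 = false) /\ (y == z2 = false).
    by move=> yA; split; apply: contraNF yA => /eqP->.
  by rewrite !inE !(n1 _ uA).1 !(n1 _ uA).2 !(n1 _ u'A).1 !(n1 _ u'A).2.
have [mC cC] := matchable_add ezz1 zB z1B mB.
exists (z |: (z1 |: B)); split=> //; last by right; rewrite cC cB -cA.
by rewrite !subUset !sub1set sBV !(subsetP sAV).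
Qed.

(* If some vertex is covered by every maximum matching, it is moved to S.
   Otherwise I is the set missed by a maximum matching: two neighbours in I of a
   vertex y would contradict the exchange lemma, as some maximum matching misses
   y (Gallai's lemma). *)
Lemma weak_tutte_berge (V : {set T}) :
  exists S I A : {set T},
    [/\ S \subset V, I \subset V :\: S, A \subset V & matchable A] /\
    [/\ #|V| + #|S| <= #|I| + #|A|,
        {in I &, forall x y, ~~ e x y} &
        {in V :\: (S :|: I), forall y, #|[set x in I | e y x]| <= 1}].
Proof.
have [k] := ubnP #|V|; elim: k V => // k IHk V ltVk.
pose P (B : {set T}) := (B \subset V) && matchable B.
have P0 : P set0 by rewrite /P sub0set matchable0.
pose A := [arg max_(B > set0 | P B) #|B|].
have [/andP[sAV mA] maxA] : P A /\ forall B, P B -> #|B| <= #|A|.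
  by rewrite /A; case: arg_maxnP.
case: (boolP [exists z in V, forall B : {set T},
   (B \subset V :\ z) && matchable B ==> (#|B| < #|A|)]).
  move=> /exists_inP[z zV /forallP Hz].
  have [|S [I [A' [[sS sI sA' mA'] [cI iI nI]]]]] := IHk (V :\ z).
    by move: ltVk; rewrite (cardsD1 z) zV.
  (* Both cardinals are even, so the strict inequality has a gap of 2. This pays for [z], which is
     counted once in V and once in the new S. *)
  have ltA : #|A'|.+2 <= #|A|.
    move: (Hz A'); rewrite sA' mA' /= => lt1.
    rewrite ltn_neqAle lt1 andbT.
    by apply: contraNneq (matchable_even mA) => <-; rewrite /= matchable_even.
  exists (z |: S), I, A; split; split=> //.
  - by rewrite subUset sub1set zV (subset_trans sS) // subD1set.
  - apply/subsetP=> y /(subsetP sI); rewrite !inE negb_or.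
    by case/and3P=> -> -> ->.
  - have zS : z \notin S.
      by apply: contraL sS => zS; apply/subsetPn; exists z; rewrite // !inE eqxx.
    move: cI; rewrite cardsU1 zS (cardsD1 z V) zV /= !add1n addSn addnS; move: ltA;
      clear; lia.
  - move=> y Hy; apply: nI; move: Hy; rewrite !inE !negb_or.
    by case/andP=> /andP[/andP[-> ->] ->] ->.
rewrite negb_exists_in => /forall_inP Hz.
exists set0, (V :\: A), A; split; split=> //.
- by rewrite sub0set.
- by rewrite setD0 subsetDl.
- by rewrite cards0 addn0 cardsD (setIidPr sAV) subnK // subset_leq_card.
- move=> x y; rewrite !inE => /andP[xA xV] /andP[yA yV]; apply/negP => exy.
  have [mB cB] := matchable_add exy xA yA mA.
  have /maxA : P (x |: (y |: A)) by rewrite /P mB !subUset !sub1set xV yV sAV.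
  by rewrite cB ltnNge leqnSn.
move=> y; rewrite set0U !inE negb_and negbK => /andP[Hy yV].
have yA : y \in A by case/orP: Hy => //; rewrite yV.
rewrite leqNgt; apply/negP => /card_gt1P[u [u' [Hu Hu' nuu']]].
move: Hu Hu'; rewrite !inE => /andP[/andP[uA uV] eyu] /andP[/andP[u'A u'V] eyu'].
have := Hz y yV; rewrite negb_forall => /existsP[A'].
rewrite negb_imply -leqNgt => /andP[/andP[sA' mA'] leAA'].
have sA'V : A' \subset V by rewrite (subset_trans sA') ?subD1set.
have eqAA' : #|A| = #|A'| by apply/eqP; rewrite eqn_leq leAA' maxA // /P sA'V.
have yA' : y \notin A'.
  by apply: contraL sA' => yA'; apply/subsetPn; exists y; rewrite // !inE eqxx.
have [B [mB sBV HB]] := matchable_exchange mA mA' sAV sA'V eqAA' nuu' uA u'A yA'.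
case: HB => [[cB [yB uB]]|cB]; last first.
  by have := maxA B; rewrite /P sBV mB cB => /(_ isT); rewrite ltnNge leqnSn.
have [w [wB wV eyw]] : exists w, [/\ w \notin B, w \in V & e y w].
  by case/orP: uB => wB; [exists u|exists u'].
have [mC cC] := matchable_add eyw yB wB mB.
have /maxA : P (y |: (w |: B)) by rewrite /P mC !subUset !sub1set yV wV sBV.
by rewrite cC cB ltnNge leqnSn.
Qed.

(** * Matchings in nearly complete bipartite graphs *)

Definition bipartite_matching (P Q : {set T}) (s : seq (T * T)) : bool :=
  [&& uniq (unzip1 s), uniq (unzip2 s) &
      all (fun p => [&& p.1 \in P, p.2 \in Q & e p.1 p.2]) s].

Lemma unmatched_vertex (P : {set T}) (s : seq T) :
  size s < #|P| -> exists2 p, p \in P & p \notin s.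
Proof.
move=> lt; have /subsetPn[p pP ps] : ~~ (P \subset s).
  by apply: contraL lt => /subset_leq_card le; rewrite -leqNgt (leq_trans le) ?card_size.
by exists p.
Qed.

(** Take unmatched [p0] and [q0]. If no edge joins two unmatched vertices, then at least [#|P| - g]
    pairs of s have their first end adjacent to [q0], and at least [#|Q| - g] have their second end
    adjacent to [p0]. The size condition forces a common pair [(p, q)], which is replaced by
    [(p, q0)] and [(p0, q)]. *)
Lemma bipartite_augment (P Q : {set T}) (g : nat) (s : seq (T * T)) :
  {in P, forall p, #|[set q in Q | ~~ e p q]| <= g} ->
  {in Q, forall q, #|[set p in P | ~~ e p q]| <= g} ->
  size s < #|P| -> size s < #|Q| -> size s + g.*2 < #|P| + #|Q| ->
  bipartite_matching P Q s ->
  exists s', bipartite_matching P Q s' /\ size s' = (size s).+1.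
Proof.
move=> gP gQ ltP ltQ ltPQ /and3P[u1 u2 /allP sPQ].
have [p0 p0P p0s] := @unmatched_vertex P (unzip1 s) ltac:(by rewrite size_map).
have [q0 q0Q q0s] := @unmatched_vertex Q (unzip2 s) ltac:(by rewrite size_map).
case: (boolP [exists p in P, exists q in Q,
        [&& p \notin unzip1 s, q \notin unzip2 s & e p q]]) => [|noadd].
  case/exists_inP=> p pP /exists_inP[q qQ /and3P[ps qs epq]].
  exists ((p, q) :: s); split=> //; apply/and3P; split=> /=; rewrite ?ps ?qs //.
  by rewrite pP qQ epq; apply/allP.
have noedge p q : p \in P -> q \in Q -> p \notin unzip1 s -> q \notin unzip2 s ->
    ~~ e p q.
  move=> pP qQ ps qs; apply: contra noadd => epq.
  by apply/exists_inP; exists p => //; apply/exists_inP; exists q; rewrite ?ps ?qs.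
case: (boolP (has (fun p => e p.1 q0 && e p0 p.2) s)) => [|noswitch].
  case/hasP=> -[p q] pqs /= /andP[epq0 ep0q].
  have perm := perm_to_rem pqs; set r := rem _ _ in perm.
  have /andP[pr ur1] : uniq (p :: unzip1 r) by rewrite -(perm_uniq (perm_map fst perm)).
  have /andP[qr ur2] : uniq (q :: unzip2 r) by rewrite -(perm_uniq (perm_map snd perm)).
  have s1 : unzip1 s =i p :: unzip1 r by apply/perm_mem/(perm_map fst perm).
  have s2 : unzip2 s =i q :: unzip2 r by apply/perm_mem/(perm_map snd perm).
  have /and3P[/= pP qQ _] := sPQ _ pqs.
  move: p0s q0s; rewrite s1 s2 !inE !negb_or => /andP[np0p p0r] /andP[nq0q q0r].
  exists [:: (p, q0), (p0, q) & r]; split; last by rewrite /= (perm_size perm).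
  apply/and3P; split=> /=.
  - by rewrite inE negb_or eq_sym np0p pr p0r.
  - by rewrite inE negb_or nq0q q0r qr.
  - rewrite pP q0Q epq0 p0P qQ ep0q /=; apply/allP => y yr.
    by apply: sPQ; rewrite (perm_mem perm) inE yr orbT.
have cP : #|P| <= g + count (fun p => e p.1 q0) s.
  rewrite -(cardsID [set p | ~~ e p q0] P); apply: leq_add.
    by apply: leq_trans (gQ _ q0Q); apply: eq_leq; apply: eq_card => y;
      rewrite !inE andbC.
  rewrite -size_filter -(size_map fst); apply: leq_trans (card_size _).
  apply/subset_leq_card/subsetP => p; rewrite !inE negbK => /andP[epq0 pP].
  have /mapP[pq pqs eqp] : p \in unzip1 s.
    by apply: contraTT epq0 => ps; apply: noedge.
  by apply/mapP; exists pq => //; rewrite mem_filter -eqp epq0.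
have cQ : #|Q| <= g + count (fun p => e p0 p.2) s.
  rewrite -(cardsID [set q | ~~ e p0 q] Q); apply: leq_add.
    by apply: leq_trans (gP _ p0P); apply: eq_leq; apply: eq_card => y;
      rewrite !inE andbC.
  rewrite -size_filter -(size_map snd); apply: leq_trans (card_size _).
  apply/subset_leq_card/subsetP => q; rewrite !inE negbK => /andP[ep0q qQ].
  have /mapP[pq pqs eqq] : q \in unzip2 s.
    by apply: contraTT ep0q => qs; apply: noedge.
  by apply/mapP; exists pq => //; rewrite mem_filter -eqq ep0q.
have := count_predUI (fun p => e p.1 q0) (fun p => e p0 p.2) s.
have /eqP-> : count (predI (fun p => e p.1 q0) (fun p => e p0 p.2)) s == 0.
  by rewrite -leqn0 leqNgt -has_count.
have := count_size (predU (fun p => e p.1 q0) (fun p => e p0 p.2)) s.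
move: cP cQ ltPQ; clear; lia.
Qed.

Lemma bipartite_matching_exists (P Q : {set T}) (g n : nat) :
  {in P, forall p, #|[set q in Q | ~~ e p q]| <= g} ->
  {in Q, forall q, #|[set p in P | ~~ e p q]| <= g} ->
  n <= #|P| -> n <= #|Q| -> n + g.*2 <= #|P| + #|Q| ->
  exists s, bipartite_matching P Q s /\ size s = n.
Proof.
move=> gP gQ leP leQ lePQ;
  suff H r : r <= n -> exists s, bipartite_matching P Q s /\ size s = r.
  exact: H.
elim: r => [|r IHr] lern; first by exists [::].
have [s [ms sz]] := IHr (ltnW lern).
have [|||s' [ms' sz']] := bipartite_augment gP gQ _ _ _ ms; rewrite ?sz.
- exact: leq_trans lern leP.
- exact: leq_trans lern leQ.
- by apply: leq_trans lePQ; rewrite ltn_add2r.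
- by exists s'; rewrite sz' sz.
Qed.

Lemma bipartite_matchable (P Q : {set T}) (s : seq (T * T)) :
  [disjoint P & Q] -> bipartite_matching P Q s ->
  exists B : {set T}, [/\ matchable B, B \subset P :|: Q & #|B| = (size s).*2].
Proof.
move=> dPQ ms.
suff [mB cB] : matchable [set x in unzip1 s ++ unzip2 s] /\
    #|[set x in unzip1 s ++ unzip2 s]| = (size s).*2.
  exists [set x in unzip1 s ++ unzip2 s]; split=> //.
  have /and3P[_ _ /allP sPQ] := ms.
  apply/subsetP=> x; rewrite !inE mem_cat => /orP[]/mapP[y /sPQ /and3P[yP yQ _] ->].
    by rewrite yP.
  by rewrite yQ orbT.
elim: s ms => [_|[p q] s IHs /and3P[/= /andP[ps u1] /andP[qs u2] /andP[/and3P[pP qQ epq] sPQ]]].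
  by rewrite (_ : [set _ in _] = set0) ?matchable0 ?cards0 //; apply/setP=> x;
    rewrite !inE.
have [mB cB] := IHs ltac:(by apply/and3P).
have qP : q \notin P by rewrite (disjointFl dPQ).
have pQ : p \notin Q by rewrite (disjointFr dPQ).
have [||mC cC] := matchable_add epq _ _ mB.
- rewrite inE mem_cat negb_or ps;
  apply: contra pQ => /mapP[y /(allP sPQ)/and3P[_ yQ _] ->] //.
- rewrite inE mem_cat negb_or qs andbT;
  apply: contra qP => /mapP[y /(allP sPQ)/and3P[yP _ _] ->] //.
rewrite (_ : [set _ in _] = p |: (q |: [set x in unzip1 s ++ unzip2 s])).
  by rewrite mC cC cB.
by apply/setP=> x; rewrite !inE !mem_cat /= inE; do !case: (_ == _); rewrite ?orbT.
Qed.

End Matchings.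

(** * Numerical inequalities for the upper bound *)

Lemma large_linear4 m p t :
  2 * p.+1 ^ 2 <= t * (m + t) -> 4 * p.+1 <= m + 3 * t.
Proof.
rewrite -mulnn => large; rewrite leqNgt; apply/negP => lt.
have le : t * (m + 3 * t).+1 <= t * (4 * p.+1) by rewrite leq_mul2l lt orbT.
(* With n = p + 1, the bound 2nt <= n^2 + t^2 is used; the line m + 3t = 4n is tangent to the curve
   t(m + t) = 2n^2 at m = t = n. *)
have := (nat_Cauchy p.+1 t).1; rewrite -!mulnn => cauchy.
have t0 : t = 0 by lia.
by rewrite t0 in large; lia.
Qed.

(** The hypotheses give 2s + i(t - s) <= 2p, while i >= m + t + s - 2p. The linear bound makes i at
    least s + 2(p - t) + 4 when t <= p; otherwise p + 1 < m gives i >= 3. Both are too large. *)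
Lemma barrier_arith m p t s i c D : 2 * p.+1 ^ 2 <= t * (m + t) ->
   p.+1 < m -> m + t <= D -> D = s + (i + c) -> D + s <= i + p.*2 -> s < t ->
   i * (t - s) <= c -> False.
Proof.
move=> large lt_p_m geD cD le lts lec.
have lin := large_linear4 large.
have [g et] : exists g, t = s + g.+1 by exists (t - s).-1; lia.
have ig : i * g.+1 + s.*2 <= p.*2 by move: lec; rewrite et addKn; lia.
case: (leqP t p) => tp.
  have [j ep] : exists j, p = t + j by exists (p - t); lia.
  have : (s + 2 * j + 4) * g.+1 <= i * g.+1 by rewrite leq_mul2r; apply/orP; right; lia.
  have : j <= j * g.+1 by rewrite leq_pmulr.
  lia.
have : 3 * g.+1 <= i * g.+1 by rewrite leq_mul2r; apply/orP; right; lia.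
lia.
Qed.

(** Put a = p - s and a' = p - s'. Substituting k, W and T bounds t(m + t) by 2p^2 - pa' + 2a + 2a'.
    Since a and a' are at most p, this stays below 2(p + 1)^2 = 2p^2 + 4p + 2. *)
Lemma final_arith m p t s s' k W T c c' : 2 * p.+1 ^ 2 <= t * (m + t) ->
   p.+1 < m -> T = m.*2 + t -> t <= s -> t <= s' -> W + t <= s + s' ->
   s.*2 + c <= p.*2 -> s'.*2 + c' <= p.*2 -> s <= s' -> k + p.*2 = m + t + s ->
   2 * k * (m + t) <= k * T + p * W + c + c' -> False.
Proof.
move=> large lt_p_m -> ts ts' leW les les' ss' ek tot.
have kt : k * t <= p * W + c + c' by nia.
have [a ep] : exists a, p = s + a by exists (p - s); lia.
have [a' ep'] : exists a', p = s' + a' by exists (p - s'); lia.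
have pW : p * W + p * t <= p * (s + s') by rewrite -mulnDr leq_mul2l leW orbT.
have es : p * (s + s') + p * a + p * a' = p * (p + p).
  by rewrite -!mulnDr; congr (_ * _); lia.
have ekt : k * t + p * t + a * t = t * (m + t).
  by rewrite -!mulnDl mulnC; congr (_ * _); lia.
have at_ : a * t <= p * a by rewrite mulnC leq_mul2r; apply/orP; right; lia.
move: large; rewrite -ekt -mulnn; lia.
Qed.

Lemma large_linear6 m p t :
  2 * p.+1 ^ 2 <= t * (m + t) -> 6 * p.+1 <= m + 6 * t.
Proof.
rewrite -mulnn => large; rewrite leqNgt; apply/negP => lt.
have le : t * (m + 6 * t).+1 <= t * (6 * p.+1) by rewrite leq_mul2l lt orbT.
(* The weights 3 and 5 yield 6nt <= (9/5) n^2 + 5t^2 for n = p + 1, and 9/5 < 2. *)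
have := (nat_Cauchy (3 * p.+1) (5 * t)).1; rewrite -!mulnn => cauchy; lia.
Qed.

Lemma subset_of_card (T : finType) (X : {set T}) (k : nat) :
  k <= #|X| -> exists2 A : {set T}, A \subset X & #|A| = k.
Proof.
move=> /card_geqP[s [us <- sX]]; exists [set y in s]; last first.
  by rewrite cardsE; apply/card_uniqP.
by apply/subsetP => y; rewrite inE => /sX.
Qed.

(** * Upper bound: few non-neighbours against small matchings in neighbourhoods *)

Section UpperBound.
Variables (T : finType) (e : rel T).
Hypotheses (e_sym : symmetric e) (e_irr : irreflexive e).

Definition nbhd (v : T) : {set T} := [set y | e v y].

Lemma double_count (X Y : {set T}) :
  \sum_(u in X) #|[set a in Y | e u a]| = \sum_(a in Y) #|[set u in X | e a u]|.
Proof.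
have card_sum (Z : {set T}) (u : T) : #|[set a in Z | e u a]| = \sum_(a in Z) e u a.
  rewrite -sum1_card big_mkcond [RHS]big_mkcond; apply: eq_bigr => a _.
  by rewrite inE; case: (a \in Z); case: (e u a).
under eq_bigr do rewrite card_sum.
rewrite exchange_big; apply: eq_bigr => a _; rewrite card_sum.
by apply: eq_bigr => u _; rewrite e_sym.
Qed.

Variables (m p : nat).
Hypothesis non_nbrs : forall x, #|[set y | ~~ e x y]| <= m.
Hypothesis no_fan : forall v A, matchable e A -> A \subset nbhd v -> #|A| <= p.*2.

(* Gallai-Edmonds-like structure of a neighbourhood: S is the barrier and I
   picks one vertex in each odd component of the rest. *)
Definition decomposition (v : T) (S I : {set T}) : Prop :=
  [/\ S \subset nbhd v, I \subset nbhd v :\: S,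
      #|nbhd v| + #|S| <= #|I| + p.*2,
      {in I &, forall x y, ~~ e x y} &
      {in nbhd v :\: (S :|: I), forall y, #|[set x in I | e y x]| <= 1}].

Lemma decomposition_exists (v : T) : exists S I, decomposition v S I.
Proof.
have [S [I [A [[sS sI sA mA] [le indI degI]]]]] := weak_tutte_berge e_sym e_irr (nbhd v).
exists S, I; split=> //; apply: leq_trans le _; rewrite leq_add2l.
exact: no_fan mA sA.
Qed.

Lemma card_decomposition (v : T) (S I : {set T}) : decomposition v S I ->
  #|nbhd v| = #|S| + (#|I| + #|nbhd v :\: (S :|: I)|).
Proof.
case=> sS sI _ _ _; rewrite -(cardsID S (nbhd v)) (setIidPr sS); congr (_ + _).
by rewrite -(cardsID I) (setIidPr sI) setDDl.
Qed.

Lemma card_nbhd (v : T) : #|T| <= #|nbhd v| + m.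
Proof.
rewrite -(cardsC (nbhd v)) leq_add2l; apply: leq_trans (non_nbrs v).
by apply: eq_leq; apply: eq_card => y; rewrite !inE.
Qed.

Variable t : nat.
Hypotheses (cardT : #|T| = m.*2 + t) (lt_p_m : p.+1 < m)
  (large : 2 * p.+1 ^ 2 <= t * (m + t)).

Lemma degree_ge (v : T) : m + t <= #|nbhd v|.
Proof. by have := card_nbhd v; rewrite cardT; lia. Qed.

(** Let C be the rest of N(v). Each vertex of C sends at most one edge to I, so I and C span at most
    [#|C|] edges, whereas each vertex of I has at least [t - #|S|] neighbours in C. This rules out
    [#|S| < t]. If every vertex of I had a neighbour in C, then [#|I| <= #|C|], against the linear
    bound. *)
Lemma decomposition_link (v : T) (S I : {set T}) : decomposition v S I ->
  t <= #|S| /\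
  exists2 x, x \in I & {in nbhd v :\: (S :|: I), forall y, ~~ e x y}.
Proof.
move=> dec; have [sS sI le indI degI] := dec.
have cD := card_decomposition dec; have geD := degree_ge v.
set C := nbhd v :\: (S :|: I) in cD degI *.
have leC : \sum_(x in I) #|[set y in C | e x y]| <= #|C|.
  rewrite double_count -sum1_card; exact: leq_sum.
have degx x : x \in I -> #|nbhd v| <= m + #|S| + #|[set y in C | e x y]|.
  move=> xI; rewrite -(cardsID (nbhd x)) addnC -addnA; apply: leq_add.
    apply: leq_trans (non_nbrs x); apply/subset_leq_card/subsetP => y.
    by rewrite !inE => /andP[].
  rewrite -cardsUI; apply: leq_trans (leq_addr _ _).
  apply/subset_leq_card/subsetP => y; rewrite !inE => /andP[vy exy].
  rewrite vy exy !andbT negb_or; case: (y \in S) => //=.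
  by apply/negP => yI; have := indI _ _ xI yI; rewrite exy.
have lin := large_linear4 large.
have tS : t <= #|S|.
  rewrite leqNgt; apply/negP => ltSt.
  have : #|I| * (t - #|S|) <= #|C|.
    apply: leq_trans leC; rewrite -sum_nat_const; apply: leq_sum => x xI.
    by have := degx x xI; lia.
  exact: barrier_arith large lt_p_m geD cD le ltSt.
split=> //.
case: (boolP [exists x in I, [set y in C | e x y] == set0]) => [|none].
  case/exists_inP => x xI /eqP eq0; exists x => // y yC; apply/negP => exy.
  by have := in_set0 y; rewrite -eq0 inE yC exy.
have : #|I| <= #|C|.
  apply: leq_trans leC; rewrite -sum1_card; apply: leq_sum => x xI.
  rewrite card_gt0; apply: contra none => eq0.
  by apply/exists_inP; exists x.
lia.
Qed.

(* The induced bipartite graph on N(u) :&: A and N(u) :&: B misses few edges, so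
   it has a matching of size p + 1 as soon as these sets are large enough. *)
Lemma codegree_bound (A B : {set T}) (k : nat) (u : T) :
  #|A| = k -> #|B| = k -> [disjoint A & B] ->
  {in A &, forall x y, ~~ e x y} -> {in B &, forall x y, ~~ e x y} ->
  2 * m <= 3 * k ->
  #|[set a in A | e u a]| + #|[set b in B | e u b]| <= k + p.
Proof.
move=> cA cB dAB indA indB lek; rewrite leqNgt; apply/negP => lt.
set P := [set a in A | e u a] in lt; set Q := [set b in B | e u b] in lt.
have sP : P \subset A by apply/subsetP => x; rewrite inE => /andP[].
have sQ : Q \subset B by apply/subsetP => x; rewrite inE => /andP[].
have leP := subset_leq_card sP; have leQ := subset_leq_card sQ.
rewrite cA in leP; rewrite cB in leQ.
(* All k vertices of X, the vertex itself included, are among its at most m non-neighbours, so at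
   most m - k remain outside X. *)
have missing (X Y Z : {set T}) : #|X| = k -> {in X &, forall x y, ~~ e x y} ->
    [disjoint X & Y] -> Z \subset Y ->
    {in X, forall x, #|[set y in Z | ~~ e x y]| <= m - k}.
  move=> cX indX dXY sZY x xX; rewrite -cX leq_subRL; last first.
    rewrite (leq_trans _ (non_nbrs x)) //; apply/subset_leq_card/subsetP => y yX.
    by rewrite inE indX.
  rewrite -cardsUI (_ : X :&: _ = set0) ?cards0 ?addn0.
    apply: leq_trans (non_nbrs x); apply/subset_leq_card/subsetP => y.
    by rewrite !inE => /orP[yX|/andP[]//]; apply: indX.
  apply/setP => y; rewrite !inE; apply/negP => /and3P[yX yZ _].
  by have := subsetP sZY _ yZ; rewrite (disjointFr dXY yX).
(* Since 2m <= 3k means 2(m - k) <= k, the assumption [#|P| + #|Q| > k + p] meets the size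
   condition. *)
have [|||||s [ms cs]] := @bipartite_matching_exists T e P Q (m - k) p.+1.
- by move=> x /(subsetP sP) xA; apply: (missing A B).
- move=> y /(subsetP sQ) yB; under eq_finset do rewrite e_sym.
  by apply: (missing B A) => //; rewrite disjoint_sym.
- lia.
- lia.
- lia.
have dPQ : [disjoint P & Q].
  by apply: disjointWl sP (disjointWr sQ dAB).
have [M [mM sM cM]] := bipartite_matchable e_sym e_irr dPQ ms.
have : #|M| <= p.*2.
  apply: (@no_fan u) => //; apply: subset_trans sM _; apply/subsetP => x.
  by rewrite !inE => /orP[]/andP[].
by rewrite cM cs; lia.
Qed.

Lemma upper_bound_contradiction : False.
Proof.
have /card_gt0P[v _] : 0 < #|T| by rewrite cardT; lia.
have [Sv [Iv decv]] := decomposition_exists v.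
have [tSv [x xIv xCv]] := decomposition_link decv.
have [Sx [Ix decx]] := decomposition_exists x.
have [tSx _] := decomposition_link decx.
have cDv := card_decomposition decv; have cDx := card_decomposition decx.
have geDv := degree_ge v; have geDx := degree_ge x.
have [sSv sIv lev indIv degIv] := decv; have [sSx sIx lex indIx degIx] := decx.
set Cv := nbhd v :\: (Sv :|: Iv) in xCv cDv degIv.
set Cx := nbhd x :\: (Sx :|: Ix) in cDx degIx.
(* This k is a lower bound for both [#|Iv|] and [#|Ix|], as all degrees are at least m + t. *)
set s0 := minn #|Sv| #|Sx|; set k := m + t + s0 - p.*2.
have lin := large_linear4 large.
have [A sA cA] : exists2 A : {set T}, A \subset Ix & #|A| = k.
  by apply: subset_of_card; rewrite /k /s0; lia.
have [B sB cB] : exists2 B : {set T}, B \subset Iv & #|B| = k.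
  by apply: subset_of_card; rewrite /k /s0; lia.
have vx : e v x by move: (subsetP sIv _ xIv); rewrite !inE => /andP[].
have sepU u : u \in nbhd v :\: Sv -> ~~ e x u.
  move=> Hu; case: (boolP (u \in Iv)) => uI; first exact: indIv.
  by apply: xCv; move: Hu; rewrite !inE negb_or uI => /andP[-> ->].
have indA : {in A &, forall y z, ~~ e y z}.
  by move=> y z yA zA; apply: indIx; apply: (subsetP sA).
have indB : {in B &, forall y z, ~~ e y z}.
  by move=> y z yB zB; apply: indIv; apply: (subsetP sB).
have dAB : [disjoint A & B].
  apply/pred0P => y; apply/negP => /andP[/(subsetP sA)/(subsetP sIx) yA].
  move=> /(subsetP sB)/(subsetP sIv)/sepU.
  by move: yA; rewrite !inE => /andP[_ ->].
pose W := ~: ((nbhd v :\: Sv) :|: (nbhd x :\: Sx)).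
have cW : #|W| + t <= #|Sv| + #|Sx|.
  have := cardsC ((nbhd v :\: Sv) :|: (nbhd x :\: Sx)); rewrite -/W cardT.
  have := cardsUI (nbhd v :\: Sv) (nbhd x :\: Sx).
  rewrite (_ : _ :&: _ = set0) ?cards0; last first.
    apply/setP => y; rewrite [in RHS]inE; apply/negP => /setIP[/sepU].
    by rewrite !inE => /negPf-> /andP[].
  have := cardsID Sv (nbhd v); have := cardsID Sx (nbhd x).
  rewrite (setIidPr sSv) (setIidPr sSx); move: geDv geDx; clear; lia.
have le3k : 2 * m <= 3 * k by move: (large_linear6 large) tSv tSx; rewrite /k /s0; clear;
  lia.
(* Outside W, one of the two sets contributes at most k trivially, and the other nothing or, for u
   in [Cv] or [Cx], at most one. On W the bound is [codegree_bound]. *)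
have bound u : #|[set a in A | e u a]| + #|[set b in B | e u b]| <=
    k + p * (u \in W) + (u \in Cv) + (u \in Cx).
  have leA : #|[set a in A | e u a]| <= k.
    by rewrite -cA; apply/subset_leq_card/subsetP => y; rewrite inE => /andP[].
  have leB : #|[set b in B | e u b]| <= k.
    by rewrite -cB; apply/subset_leq_card/subsetP => y; rewrite inE => /andP[].
  case: (boolP (u \in nbhd v :\: Sv)) => uv.
    suff le1 : #|[set b in B | e u b]| <= (u \in Cv).
      apply: leq_trans (leq_addr _ _); apply: leq_add le1.
      by apply: leq_trans leA (leq_addr _ _).
    case: (boolP (u \in Iv)) => uI.
      rewrite (_ : [set _ in _ | _] = set0) ?cards0 //; apply/setP => y.
      rewrite !inE; apply/negP => /andP[yB]; apply/negP.
      by apply: indIv => //; apply: (subsetP sB).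
    have uC : u \in Cv by move: uv; rewrite !inE negb_or uI => /andP[-> ->].
    rewrite uC; apply: leq_trans (degIv _ uC).
    apply/subset_leq_card/subsetP => y; rewrite !inE => /andP[yB ->].
    by rewrite (subsetP sB).
  case: (boolP (u \in nbhd x :\: Sx)) => ux.
    suff le1 : #|[set a in A | e u a]| <= (u \in Cx).
      rewrite [leqLHS]addnC; apply: leq_add le1; apply: leq_trans leB _.
      by rewrite -addnA leq_addr.
    case: (boolP (u \in Ix)) => uI.
      rewrite (_ : [set _ in _ | _] = set0) ?cards0 //; apply/setP => y.
      rewrite !inE; apply/negP => /andP[yA]; apply/negP.
      by apply: indIx => //; apply: (subsetP sA).
    have uC : u \in Cx by move: ux; rewrite !inE negb_or uI => /andP[-> ->].
    rewrite uC; apply: leq_trans (degIx _ uC).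
    apply/subset_leq_card/subsetP => y; rewrite !inE => /andP[yA ->].
    by rewrite (subsetP sA).
  have -> : u \in W by rewrite inE inE negb_or uv ux.
  apply: leq_trans (codegree_bound u cA cB dAB indA indB le3k) _.
  by rewrite muln1 -addnA leq_addr.
have total : 2 * k * (m + t) <= k * #|T| + p * #|W| + #|Cv| + #|Cx|.
  have -> : k * #|T| + p * #|W| + #|Cv| + #|Cx| =
      \sum_u (k + p * (u \in W) + (u \in Cv) + (u \in Cx)).
    by rewrite !big_split /= sum_nat_const -big_distrr /= -!big_mkcond /= !sum1_card mulnC.
  apply: leq_trans (leq_sum _ (fun u _ => bound u)).
  have nbT (X : {set T}) : #|X| = k -> k * (m + t) <= \sum_u #|[set a in X | e u a]|.
    move=> cX; rewrite -cX.
    rewrite (eq_bigl (fun u => u \in [set: T])) => [|u]; last by rewrite inE.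
    rewrite double_count.
    rewrite -sum_nat_const; apply: leq_sum => a _; apply: leq_trans (degree_ge a) _.
    by apply/subset_leq_card/subsetP => y; rewrite !inE.
  by rewrite big_split /=; have := nbT A cA; have := nbT B cB; clear; lia.
have leCv : #|Sv|.*2 + #|Cv| <= p.*2 by move: lev cDv; clear; lia.
have leCx : #|Sx|.*2 + #|Cx| <= p.*2 by move: lex cDx; clear; lia.
have ek : k + p.*2 = m + t + s0.
  by rewrite /k subnK //; move: (large_linear6 large) tSv tSx; rewrite /s0; clear; lia.
(* The final inequality expects the smaller barrier first; the other case exchanges v and x. *)
case: (leqP #|Sv| #|Sx|) => [leS|/ltnW leS].
  rewrite /s0 (minn_idPl leS) in ek.
  exact: (final_arith large lt_p_m cardT tSv tSx cW leCv leCx leS ek total).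
rewrite (addnC #|Sv|) in cW; rewrite addnAC in total.
rewrite /s0 (minn_idPr leS) in ek.
exact: (final_arith large lt_p_m cardT tSx tSv cW leCx leCv leS ek total).
Qed.

End UpperBound.

(** * Passing between graphs and colourings of complete graphs *)

Lemma arrows_of_large (m p t : nat) : p.+1 < m -> 2 * p.+1 ^ 2 <= t * (m + t) ->
  arrows (star m) (fan p.+1) (m.*2 + t).
Proof.
move=> lt_p_m large; apply/forallP => c; apply: contraT.
rewrite negb_or => /andP[/existsP nostar /existsP nofan].
pose e (x y : 'I_(m.*2 + t)) := (x != y) && c [set x; y].
have e_sym : symmetric e by move=> x y; rewrite /e eq_sym setUC.
have e_irr : irreflexive e by move=> x; rewrite /e eqxx.
exfalso; apply: (@upper_bound_contradiction _ e e_sym e_irr m p _ _ t) => //.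
- move=> x; rewrite leqNgt; apply/negP => lt; apply: nostar.
  (* [Y] contains [x] itself, so more than m elements leave m leaves for a star of colour 1. *)
  set Y := [set y | ~~ e x y] in lt; have xY : x \in Y by rewrite inE e_irr.
  have leY : m <= size (enum (Y :\ x)).
    by rewrite -cardE; move: lt; rewrite (cardsD1 x Y) xY add1n ltnS.
  pose f (u : star m) := if u is Some i then nth x (enum (Y :\ x)) i else x.
  have fY i : f (Some i) \in Y :\ x.
    by rewrite -mem_enum mem_nth // (leq_trans (ltn_ord i)).
  have nfx i : f (Some i) != x by have := fY i; rewrite !inE => /andP[].
  have cf i : c [set x; f (Some i)] = false.
    by have := fY i; rewrite !inE /e eq_sym => /andP[-> /=] /negbTE.
  exists (finfun f); apply/andP; split.
    apply/injectiveP => u v; rewrite !ffunE.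
    case: u => [i|]; case: v => [j|] //.
    + move=> /eqP; rewrite nth_uniq ?enum_uniq ?(leq_trans (ltn_ord _)) //.
      by move=> /eqP/val_inj->.
    + by move=> /eqP; rewrite (negPf (nfx i)).
    + by move=> /esym/eqP; rewrite (negPf (nfx j)).
  apply/forallP => u; apply/forallP => v; rewrite !ffunE; apply/implyP.
  by case: u => [i|]; case: v => [j|] // _; rewrite ?(setUC [set f (Some i)]) cf.
- move=> v A mA sA; rewrite leqNgt; apply/negP => lt; apply: nofan.
  (* By parity, more than 2p covered vertices means at least 2p + 2. *)
  have leA : p.+1.*2 <= #|A|.
    rewrite doubleS ltn_neqAle lt andbT;
      apply: contraNneq (matchable_even e_irr mA) => <-.
    by rewrite /= odd_double.
  have [s [size_s uniq_s sub_s e_s]] := matchable_pairs e_irr v mA leA.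
  pose f (u : fan p.+1) := if u is Some (i, b) then nth v s (i.*2 + b) else v.
  have lt_s (i : 'I_p.+1) (b : bool) : i.*2 + b < size s.
    by rewrite size_s; have := ltn_ord i; case: b; lia.
  have fN i b : e v (f (Some (i, b))).
    have := subsetP sA _ (sub_s _ (mem_nth v (lt_s i b))); by rewrite inE.
  have nfv i b : f (Some (i, b)) != v.
    by apply: contraTneq (fN i b) => ->; rewrite e_irr.
  have c_e x y : e x y -> c [set x; y] == true by case/andP=> _ ->.
  exists (finfun f); apply/andP; split.
    apply/injectiveP => u w; rewrite !ffunE.
    case: u => [[i a]|]; case: w => [[j b]|] //.
    + move=> /eqP; rewrite nth_uniq // => /eqP eqij.
      have eqab : a = b by move: (congr1 odd eqij); rewrite !oddD !odd_double !oddb.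
      suff -> : i = j by rewrite eqab.
      by apply: val_inj; move: eqij; rewrite eqab => /addIn/double_inj.
    + by move=> /eqP; rewrite (negPf (nfv i a)).
    + by move=> /esym/eqP; rewrite (negPf (nfv j b)).
  apply/forallP => u; apply/forallP => w; rewrite !ffunE; apply/implyP => uw.
  apply: c_e; case: u w uw => [[i a]|] [[j b]|] //=.
  + case/andP=> /eqP<-; case: a; case: b => //= _; rewrite ?addn0 ?addn1.
      by rewrite e_sym; apply: e_s.
    exact: e_s.
  + by rewrite e_sym; have := fN i a.
  + by have := fN j b.
- by rewrite card_ord.
Qed.

(** Give colour 2 to the edges of e restricted to N vertices. A star of colour 1 would be m + 1
    non-neighbours of its centre, the centre included. In a fan of colour 2 with centre v, each of
    the n disjoint outer edges has an end in S, a vertex cover of the neighbourhood of v with fewer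
    than n elements. *)
Lemma not_arrows (T : finType) (e : rel T) (m n N : nat) :
  symmetric e -> irreflexive e ->
  (forall x, #|[set y | ~~ e x y]| <= m) ->
  (forall v, exists2 S : {set T}, #|S| < n &
     forall y z, e v y -> e v z -> e y z -> (y \in S) || (z \in S)) ->
  N <= #|T| -> ~~ arrows (star m) (fan n) N.
Proof.
move=> e_sym e_irr non_nbrs cover leN.
pose g (i : 'I_N) : T := enum_val (widen_ord leN i).
have g_inj : injective g.
  by move=> i j /enum_val_inj/(congr1 val) /= /val_inj.
pose c : coloring N := [ffun S =>
  [exists x, exists y, (S == [set x; y]) && e (g x) (g y)]].
have cE x y : c [set x; y] = e (g x) (g y).
  rewrite ffunE; apply/existsP/idP => [[x' /existsP[y' /andP[/eqP eqS exy']]]|exy].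
    have /set2P xin : x \in [set x'; y'] by rewrite -eqS set21.
    have /set2P yin : y \in [set x'; y'] by rewrite -eqS set22.
    have /set2P xin' : x' \in [set x; y] by rewrite eqS set21.
    have /set2P yin' : y' \in [set x; y] by rewrite eqS set22.
    case: xin yin xin' yin' exy' => -> [] -> //.
    - by move=> _ [] ->; rewrite e_irr.
    - by rewrite e_sym.
    - by move=> [] -> _; rewrite e_irr.
  by exists x; apply/existsP; exists y; rewrite eqxx.
rewrite negb_forall; apply/existsP; exists c; rewrite negb_or.
apply/andP; split; apply/existsP => -[f /andP[/injectiveP f_inj /forallP Hf]].
  have gf_inj : injective (g \o f) by apply: inj_comp.
  have : #|[set (g \o f) u | u in [set: star m]]| <= m.
    apply: leq_trans (non_nbrs (g (f None))); apply/subset_leq_card/subsetP.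
    move=> _ /imsetP[[i|] _ ->]; rewrite inE /=; last by rewrite e_irr.
    have /forallP/(_ (Some i)) := Hf None.
    by rewrite /= cE => /eqP->.
  by rewrite card_imset // cardsT card_option card_ord ltnn.
have [S ltS HS] := cover (g (f None)).
have ef u w : edge u w -> e (g (f u)) (g (f w)).
  by move=> uw; have /forallP/(_ w)/implyP/(_ uw) := Hf u; rewrite cE => /eqP.
pose h (i : 'I_n) := if g (f (Some (i, false))) \in S then g (f (Some (i, false)))
                     else g (f (Some (i, true))).
have hS i : h i \in S.
  rewrite /h; case: ifP => // nS.
  have := HS (g (f (Some (i, false)))) (g (f (Some (i, true)))).
  by rewrite nS; apply; apply: ef => //=; rewrite eqxx.
have h_inj : injective h.
  move=> i j; rewrite /h; case: ifP => _; case: ifP => _ /g_inj/f_inj => -[] //.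
have : #|[set h i | i in [set: 'I_n]]| <= #|S|.
  by apply/subset_leq_card/subsetP => _ /imsetP[i _ ->].
by rewrite card_imset // cardsT card_ord leqNgt ltS.
Qed.

Lemma ramsey_gt (m n N : nat) :
  (forall N', N' <= N -> ~~ arrows (star m) (fan n) N') -> N < ramsey (star m) (fan n).
Proof.
rewrite /ramsey; case: ex_minnP => R arR _ H; rewrite ltnNge; apply/negP => leR.
by have := H _ leR; rewrite arR.
Qed.

Lemma card_seq (k : nat) (Z : {set 'I_k}) : #|Z| = size [seq val z | z <- enum Z].
Proof. by rewrite size_map -cardE. Qed.

(** * Lower bound: the extremal construction *)

Section LowerBound.
Variables i s y : nat.

(** The integers below [i * y] are cut into i consecutive blocks of length y; row [x] is joined to
    the residues modulo s of its block. This makes the column degrees nearly equal. *)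
Definition cyclic_adj (x : 'I_i) (z : 'I_s) : bool :=
  [exists r : 'I_y, (x * y + r) %% s == z].

Lemma card_cyclic_row (x : 'I_i) : y <= s -> #|[set z | cyclic_adj x z]| = y.
Proof.
move=> le_ys; rewrite card_seq -[RHS](size_iota 0).
rewrite -[RHS](size_map (fun r => (x * y + r) %% s)).
apply/perm_size/uniq_perm.
- by rewrite map_inj_uniq ?enum_uniq //; apply: val_inj.
- rewrite map_inj_in_uniq ?iota_uniq // => r r'; rewrite !mem_iota => lt lt' /eqP.
  by rewrite eqn_modDl !modn_small ?(leq_trans _ le_ys) // => /eqP.
move=> z; apply/mapP/mapP => [[z']|[r]].
  rewrite mem_enum inE => /existsP[r /eqP eqz] ->.
  by exists (val r); rewrite ?mem_iota ?eqz ?ltn_ord.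
rewrite mem_iota => lt_ry ->.
have lt : (x * y + r) %% s < s by rewrite ltn_mod; apply: leq_trans le_ys;
  apply: leq_trans lt_ry.
exists (Ordinal lt) => //; rewrite mem_enum inE.
by apply/existsP; exists (Ordinal lt_ry).
Qed.

(** Integers in the same class modulo s differ by at least s >= y, hence lie in different blocks. *)
Lemma divn_step (q q' z : nat) : 0 < y -> y <= s -> q < q' ->
  (q * s + z) %/ y < (q' * s + z) %/ y.
Proof.
move=> y0 le_ys lt; have le : 1 * y + (q * s + z) <= q' * s + z.
  by rewrite addnA leq_add2r mul1n; apply: leq_trans (leq_mul lt (leqnn s));
    rewrite mulSn leq_add2r.
by have := leq_div2r y le; rewrite divnMDl.
Qed.

Lemma card_cyclic_column_ge (k : nat) (z : 'I_s) :
  0 < y -> y <= s -> k * s <= i * y -> k <= #|[set x | cyclic_adj x z]|.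
Proof.
move=> y0 le_ys le; rewrite card_seq -{1}[k](size_iota 0).
rewrite -(size_map (fun q => (q * s + z) %/ y) (iota 0 k)); apply: uniq_leq_size.
  rewrite map_inj_in_uniq ?iota_uniq // => q q' _ _ eqq.
  case: (ltngtP q q') => // lt; have := divn_step z y0 le_ys lt.
    by move: eqq => /= ->; rewrite ltnn.
  by move: eqq => /= <-; rewrite ltnn.
move=> x /mapP[q]; rewrite mem_iota add0n => /andP[_ ltq] ->.
have lt : (q * s + z) %/ y < i.
  rewrite ltn_divLR //; apply: leq_trans le; apply: leq_trans (leq_mul ltq (leqnn s)).
  by rewrite mulSn addnC ltn_add2r.
apply/mapP; exists (Ordinal lt) => //; rewrite mem_enum inE; apply/existsP.
exists (Ordinal (ltn_pmod (q * s + z) y0)).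
by rewrite /= -divn_eq modnMDl modn_small.
Qed.

(** A row adjacent to [z] contains some [q * s + z] with [q < k] in its block, and is recovered from
    q as the quotient by y. *)
Lemma card_cyclic_column_le (k : nat) (z : 'I_s) :
  i * y <= k * s -> #|[set x | cyclic_adj x z]| <= k.
Proof.
move=> le; rewrite card_seq -[k](size_iota 0).
rewrite -(size_map (fun q => (q * s + z) %/ y) (iota 0 k)); apply: uniq_leq_size.
  by rewrite map_inj_uniq ?enum_uniq //; apply: val_inj.
move=> _ /mapP[x + ->]; rewrite mem_enum inE => /existsP[r /eqP eqz].
have s0 : 0 < s by apply: leq_ltn_trans (ltn_ord z).
have y0 : 0 < y by apply: leq_ltn_trans (ltn_ord r).
apply/mapP; exists ((x * y + r) %/ s).
  rewrite mem_iota add0n ltn_divLR //=; apply: leq_trans le.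
  apply: leq_trans (leq_mul (ltn_ord x) (leqnn y)).
  by rewrite mulSn addnC ltn_add2r.
by rewrite -eqz -divn_eq divnMDl // divn_small ?addn0.
Qed.

(* Two copies of an independent set 'I_i and of an independent set 'I_s: the two
   copies of 'I_i are completely joined, each 'I_i is completely joined to the
   other copy of 'I_s and joined to its own one by a nearly biregular graph. *)
Definition lower_edge : rel (bool * ('I_i + 'I_s)) := fun u v =>
  match u.2, v.2 with
  | inl _, inl _ => u.1 != v.1
  | inl x, inr z | inr z, inl x => (u.1 != v.1) || cyclic_adj x z
  | inr _, inr _ => false
  end.

Lemma lower_sym : symmetric lower_edge.
Proof. by move=> [a [x|z]] [b [x'|z']]; rewrite /lower_edge /= 1?eq_sym. Qed.

Lemma lower_irr : irreflexive lower_edge.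
Proof. by move=> [a [x|z]]; rewrite /lower_edge /= ?eqxx. Qed.

Variables m p : nat.
(** [eq_im] gives a vertex of ['I_i] exactly i + (s - y) = m non-neighbours. [lo] makes column
    degrees at least s + y, which does the same as an upper bound for ['I_s]. [le_syp] and [hi] keep
    the covers of neighbourhoods within p. *)
Hypotheses (eq_im : i + s = m + y) (le_ys : y <= s) (le_syp : s + y <= p)
  (lo : (s + y) * s <= i * y) (hi : i * y <= p * s).

Lemma s_pos_y_pos (z : 'I_s) : 0 < y.
Proof.
have s0 : 0 < s by apply: leq_ltn_trans (ltn_ord z).
rewrite lt0n; apply: contraTneq lo => ->.
by rewrite muln0 addn0 -ltnNge muln_gt0 s0.
Qed.

Lemma lower_non_nbrs (u : bool * ('I_i + 'I_s)) : #|[set v | ~~ lower_edge u v]| <= m.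
Proof.
case: u => [a [x|z]].
  have sub : [set v | ~~ lower_edge (a, inl x) v] \subset
      [set (a, inl x') | x' in [set: 'I_i]] :|:
      [set (a, inr z) | z in ~: [set z | cyclic_adj x z]].
    apply/subsetP => -[b [x'|z]]; rewrite inE /lower_edge /= inE.
      by rewrite negbK => /eqP->; rewrite imset_f // inE.
    by rewrite negb_or negbK => /andP[/eqP<- nadj];
      rewrite (imset_f (fun z => (a, inr z))) ?orbT // !inE.
  apply: leq_trans (subset_leq_card sub) _; apply: leq_trans (leq_card_setU _ _) _.
  apply: leq_trans (leq_add (leq_imset_card _ _) (leq_imset_card _ _)) _.
  have := cardsC [set z | cyclic_adj x z].
  by rewrite card_cyclic_row // cardsT !card_ord; move: eq_im; clear; lia.
have sub : [set v | ~~ lower_edge (a, inr z) v] \subset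
    [set (w.1, inr w.2) | w in [set: bool * 'I_s]] :|:
    [set (a, inl x) | x in ~: [set x | cyclic_adj x z]].
  apply/subsetP => -[b [x|z']]; rewrite inE /lower_edge /= inE.
    by rewrite negb_or negbK => /andP[/eqP<- nadj];
      rewrite (imset_f (fun z => (a, inl z))) ?orbT // !inE.
  by rewrite (imset_f (fun w => (w.1, inr w.2)) (x := (b, z'))).
apply: leq_trans (subset_leq_card sub) _; apply: leq_trans (leq_card_setU _ _) _.
apply: leq_trans (leq_add (leq_imset_card _ _) (leq_imset_card _ _)) _.
have := cardsC [set x | cyclic_adj x z].
have := card_cyclic_column_ge z (s_pos_y_pos z) le_ys lo.
rewrite cardsT card_prod card_bool !card_ord; move: eq_im; clear; lia.
Qed.

(** For u in a copy of ['I_i], the neighbours in both copies of ['I_s] form the cover: the others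
    lie in the opposite, independent ['I_i]. For u in a copy of ['I_s], the neighbours in its own
    ['I_i] do. *)
Lemma lower_cover (u : bool * ('I_i + 'I_s)) :
  exists2 S : {set bool * ('I_i + 'I_s)}, #|S| < p.+1 &
    forall v w, lower_edge u v -> lower_edge u w -> lower_edge v w ->
      (v \in S) || (w \in S).
Proof.
case: u => [a [x|z]].
  pose S : {set bool * ('I_i + 'I_s)} := [set (~~ a, inr z) | z in [set: 'I_s]]
    :|: [set (a, inr z) | z in [set z | cyclic_adj x z]].
  exists S.
    rewrite ltnS; apply: leq_trans le_syp; apply: leq_trans (leq_card_setU _ _) _.
    apply: leq_add; apply: leq_trans (leq_imset_card _ _) _.
      by rewrite cardsT card_ord.
    by rewrite card_cyclic_row.
  have inr_cover b z : lower_edge (a, inl x) (b, inr z) -> (b, inr z) \in S.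
    rewrite /lower_edge /= inE; case: eqVneq => [<- adj|nab _].
      by rewrite (imset_f (fun z => (a, inr z))) ?orbT // inE.
    have -> : b = ~~ a by move: nab; clear S; case: a; case: b.
    by rewrite (imset_f (fun z => (~~ a, inr z))).
  move=> [b [x'|z]] [c [x''|z']] uv uw.
  - by move: uv uw; rewrite /lower_edge /=; case: (a); case: b; case: c.
  - by rewrite (inr_cover _ _ uw) orbT.
  - by rewrite (inr_cover _ _ uv).
  - by rewrite (inr_cover _ _ uv).
pose S : {set bool * ('I_i + 'I_s)} :=
  [set (a, inl x) | x in [set x | cyclic_adj x z]].
exists S.
  by rewrite ltnS; apply: leq_trans (leq_imset_card _ _) (card_cyclic_column_le z hi).
have inl_cover x : lower_edge (a, inr z) (a, inl x) -> (a, inl x) \in S.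
  rewrite /lower_edge /= eqxx /= => adj.
  by rewrite (imset_f (fun x => (a, inl x))) // inE.
move=> [b [x|z1]] [c [x'|z2]] // uv uw; rewrite [lower_edge (b, _) _]/lower_edge /=.
have [eba|nba] := eqVneq b a.
  by move: uv; rewrite eba => uv; rewrite inl_cover.
have [eca|nca] := eqVneq c a.
  by move: uw; rewrite eca => uw; rewrite inl_cover ?orbT.
by move: nba nca; case: (a); case: (b); case: (c).
Qed.

Lemma ramsey_lower : 2 * (m + y) < ramsey (star m) (fan p.+1).
Proof.
apply: ramsey_gt => N leN.
apply: (not_arrows lower_sym lower_irr lower_non_nbrs lower_cover).
apply: leq_trans leN _; rewrite card_prod card_bool card_sum !card_ord.
by rewrite eq_im.
Qed.

End LowerBound.

(** * Choice of the parameters and the real estimates *)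

Lemma exists_max_nat (P : pred nat) (b : nat) :
  P 0 -> ~~ P b -> exists y, P y /\ ~~ P y.+1.
Proof.
move=> P0; elim: b => [|b IHb]; first by rewrite P0.
by case: (boolP (P b)) => [Pb nPb|/IHb//]; exists b.
Qed.

(* The parameters of the construction are s + y = r, the integer part of
   sqrt (y (m + 2 y)), which is at most n - 5. *)
Lemma ramsey_lower_nat (m p : nat) : p.+1 < m ->
  exists y, 2 * (m + y) < ramsey (star m) (fan p.+1) /\
            2 * p.+1 ^ 2 < (2 * y + 9) * (m + (2 * y + 9)).
Proof.
move=> lt_p_m; set n := p.+1.
(* The disjunct [y == 0] makes P hold at 0, where the graph is complete bipartite with parts of size
   m. Failure at y + 1 turns 7 into the 9 of the claim. *)
pose P y := (y == 0) || ((2 * y + 7) * (m + (2 * y + 7)) <= 2 * n ^ 2).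
have nPb : ~~ P (n ^ 2).+1.
  rewrite /P /= -ltnNge; apply: leq_trans (leq_pmulr _ _);
    last by rewrite addn_gt0 addnS orbT.
  by clear; lia.
have [//|y [Py nPy]] := exists_max_nat _ nPb.
exists y; split; last first.
  move: nPy; rewrite /P /= -ltnNge; congr (_ < _ * (_ + _)); clear; lia.
case: (posnP y) Py {nPy nPb} => [->|y0].
  by move=> _; apply: (@ramsey_lower m 0 0); rewrite ?muln0.
rewrite /P -[y == 0]negbK -lt0n y0 /= => le.
(* With s = r - y and i = m + 2y - r, the condition [lo] is equivalent to r^2 <= Q. *)
pose Q := y * (m + 2 * y).
have [|r [leQ ltQ]] := @exists_max_nat (fun r => r * r <= Q) Q.+1 isT.
  by rewrite /= -ltnNge mulSn ltn_addr.
rewrite -ltnNge in ltQ; rewrite -mulnn in le.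
have le2ym : 2 * y <= m.
  rewrite leqNgt; apply/negP => lt.
  have : m * (2 * m) <= (2 * y + 7) * (m + (2 * y + 7)) by apply: leq_mul; lia.
  have : n * n < m * m by apply: ltn_mul.
  by move: le; clear; lia.
have le2yr : 2 * y <= r.
  rewrite leqNgt; apply/negP => lt.
  have : r.+1 * r.+1 <= (2 * y) * (2 * y) by apply: leq_mul.
  have : y * (2 * y) <= y * m by rewrite leq_mul2l le2ym orbT.
  by move: ltQ; rewrite /Q; clear; lia.
have ler : r + 4 <= p.
  rewrite leqNgt; apply/negP => lt.
  (* If n <= r + 4, then r^2 <= Q and the choice of y force 7m + 28y + 17 <= 16r; squaring
     contradicts r^2 <= y(m + 2y). *)
  have le1 : n * n <= (r + 4) * (r + 4) by apply: leq_mul.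
  have le2 : 7 * m + 28 * y + 17 <= 16 * r.
    by move: le1 le leQ; rewrite /Q; clear; lia.
  have le3 : (7 * m + 28 * y + 17) * (7 * m + 28 * y + 17) <= (16 * r) * (16 * r).
    exact: leq_mul.
  have := (nat_Cauchy m (2 * y)).1; rewrite -!mulnn.
  by move: le3 leQ y0; rewrite /Q; clear; nia.
have [d ed] : exists d, p = r + 4 + d by exists (p - (r + 4)); lia.
have [s es] : exists s, r = s + y by exists (r - y); lia.
have [i ei] : exists i, i + r = m + 2 * y by exists (m + 2 * y - r); lia.
rewrite es in leQ ltQ le2yr ei; rewrite /Q {le le2ym} in leQ ltQ.
have eQ : y * (m + 2 * y) = y * i + y * s + y * y by rewrite -ei -!mulnDr addnA.
rewrite eQ in leQ ltQ.
apply: (@ramsey_lower i s).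
- by move: ei; clear; lia.
- by move: le2yr; clear; lia.
- by rewrite ed es; clear; lia.
- by move: leQ; clear; lia.
(* Maximality of r gives iy <= s(s + y) + 2s + 2y. As y <= s, the excess is at most 4s, covered by p
   >= r + 4. *)
- rewrite ed es; move: ltQ le2yr; clear; lia.
Qed.

Lemma ramsey_upper_nat (m p : nat) : p.+1 < m ->
  ramsey (star m) (fan p.+1) <= m.*2 \/
  exists t, ramsey (star m) (fan p.+1) = (m.*2 + t).+1 /\ t * (m + t) < 2 * p.+1 ^ 2.
Proof.
move=> lt_p_m; rewrite /ramsey; case: ex_minnP => R arR minR.
case: (leqP R m.*2) => ltR; [by left | right].
have [t et] : exists t, R = (m.*2 + t).+1 by exists (R - m.*2).-1; lia.
exists t; split=> //; rewrite ltnNge; apply/negP => large.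
by have := minR _ (arrows_of_large lt_p_m large); rewrite et ltnn.
Qed.

Local Open Scope ring_scope.

(** Since (m + 2u)^2 = m^2 + 4u(m + u), comparing u(m + u) with 2n^2 amounts to comparing m + 2u
    with the square root X. *)
Lemma ramsey_bounds (R : rcfType) (n m : nat) : (2 <= n)%N -> (n < m)%N ->
  (3 * m%:R + Num.sqrt (m%:R ^+ 2 + 8 * n%:R ^+ 2)) / 2 - 8
    < (ramsey (star m) (fan n))%:R :> R
  /\ (ramsey (star m) (fan n))%:R
    < (3 * m%:R + Num.sqrt (m%:R ^+ 2 + 8 * n%:R ^+ 2)) / 2 + 1 :> R.
Proof.
case: n => // p _ lt_p_m; set n := p.+1 in lt_p_m *.
set X := Num.sqrt _.
have m0 : 0 < m%:R :> R by rewrite ltr0n (leq_ltn_trans _ lt_p_m).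
have X_lt (u : nat) : (2 * n ^ 2 < u * (m + u))%N -> X < m%:R + 2 * u%:R.
  move=> lt; have ge0 : 0 <= m%:R + 2 * u%:R :> R by rewrite addr_ge0 ?mulr_ge0 ?ler0n.
  rewrite -(ger0_norm ge0) -sqrtr_sqr ltr_sqrt; last first.
    by rewrite exprn_gt0 // ltr_pwDl ?mulr_ge0 ?ler0n.
  by move: lt; rewrite -(ltr_nat R) !natrM natrD; lra.
have lt_X (u : nat) : (u * (m + u) < 2 * n ^ 2)%N -> m%:R + 2 * u%:R < X.
  move=> lt; have ge0 : 0 <= m%:R + 2 * u%:R :> R by rewrite addr_ge0 ?mulr_ge0 ?ler0n.
  rewrite -(ger0_norm ge0) -sqrtr_sqr ltr_sqrt; last first.
    by rewrite ltr_pwDl ?exprn_gt0 ?mulr_ge0 ?exprn_ge0 ?ler0n.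
  by move: lt; rewrite -(ltr_nat R) !natrM natrD; lra.
split.
  (* Here X < m + 4y + 18, so (3m + X)/2 - 8 < 2m + 2y + 1, which is the integer lower bound
     exactly. *)
  have [y [lt /X_lt ltX]] := ramsey_lower_nat lt_p_m.
  rewrite natrD natrM in ltX.
  move: lt; rewrite -(ler_nat R) -/n -addn1 natrD natrM natrD; lra.
have [le|[t [-> /lt_X lt]]] := ramsey_upper_nat lt_p_m.
  have : m%:R + 2 * 0%:R < X by apply: lt_X; rewrite mul0n muln_gt0 expn_gt0.
  by move: le; rewrite -(ler_nat R) -addnn natrD; lra.
by rewrite -addn1 -addnn !natrD; lra.
Qed.

Theorem theorem1p2 (R : rcfType) :
  (forall n m : nat, (2 <= n)%N -> (n < m)%N ->
     (3 * m%:R + Num.sqrt (m%:R ^+ 2 + 8 * n%:R ^+ 2)) / 2 - 8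
       < (ramsey (star m) (fan n))%:R :> R
     /\ (ramsey (star m) (fan n))%:R
       < (3 * m%:R + Num.sqrt (m%:R ^+ 2 + 8 * n%:R ^+ 2)) / 2 + 1 :> R)
  /\
  (forall n : nat, (2 <= n)%N ->
     (3 + Num.sqrt 3) * n%:R - 8 < (ramsey (star (2 * n)%N) (fan n))%:R :> R
     /\ (ramsey (star (2 * n)%N) (fan n))%:R < (3 + Num.sqrt 3) * n%:R + 1 :> R).
Proof.
split=> n; first exact: ramsey_bounds.
move=> le2n; have lt : (n < 2 * n)%N by rewrite mul2n -addnn -addn1 leq_add2l ltnW.
have := ramsey_bounds R le2n lt.
suff -> : Num.sqrt ((2 * n)%:R ^+ 2 + 8 * n%:R ^+ 2) = 2 * n%:R * Num.sqrt 3 :> R.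
  by rewrite natrM => -[lower upper]; split; lra.
have ge0 : 0 <= 2 * n%:R :> R by rewrite mulr_ge0 ?ler0n.
rewrite -[in RHS](ger0_norm ge0) -sqrtr_sqr -sqrtrM ?sqr_ge0 // natrM.
by congr Num.sqrt; ring.
Qed.
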